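(* Let $s,t\geq 1$ be two positive integers. For all sufficiently large $n$, every $n$-vertex oriented graph $\overrightarrow{G}$ with $|E(\overrightarrow{G})|\geq e\,s^{\frac{1}{t}}n^{2-\frac{1}{t}}$ contains at least $\left(\frac{e}{t}\right)^t n^t$ copies of $\overrightarrow{K}_{s,t}$, where $e$ denotes Euler's number.
   Context: An oriented graph is a (finite) digraph without loops, without parallel arcs and without directed cycles of length two; $E(\overrightarrow{G})$ is its set of arcs. $\overrightarrow{K}_{s,t}$ is the antidirected complete bipartite oriented graph: its vertex set is a disjoint union $A\cup B$ with $|A|=s$, $|B|=t$, and its arcs are all the arcs from a vertex of $A$ to a vertex of $B$. A copy of $\overrightarrow{K}_{s,t}$ in $\overrightarrow{G}$ is a (not necessarily induced) subdigraph of $\overrightarrow{G}$ isomorphic to $\overrightarrow{K}_{s,t}$. ''Sufficiently large $n$'' means $n\ge n_0$ for some $n_0$ depending only on $s$ and $t$. *)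

(* Defs.v *)
From HB Require Import structures.
From mathcomp Require Import all_boot.
From mathcomp Require Import boolp.

Set Implicit Arguments.
Unset Strict Implicit.
Unset Printing Implicit Defensive.

(* Arcs form a set of ordered pairs, so there are no parallel arcs. *)
Record digraph := Digraph {
  vertex :> finType;
  arcs : {set vertex * vertex}
}.

Definition oriented (G : digraph) : Prop :=
  (forall x : G, (x, x) \notin arcs G) /\
  (forall x y : G, (x, y) \in arcs G -> (y, x) \notin arcs G).

Definition digraph_iso (G H : digraph) : Prop :=
  exists f : G -> H, bijective f /\
    forall x y : G, ((f x, f y) \in arcs H) = ((x, y) \in arcs G).

Definition antidirected_Kst (s t : nat) : digraph :=
  @Digraph ('I_s + 'I_t)%type
    [set (inl a, inr b) | a in 'I_s, b in 'I_t].

(* A pair (W, F) of a vertex set and an arc set is a subdigraph of G when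
   F consists of arcs of G with both endpoints in W; F need not contain all
   of them. *)
Definition is_subdigraph (G : digraph) (S : {set G} * {set G * G}) : Prop :=
  S.2 \subset arcs G /\
  (forall x y : G, (x, y) \in S.2 -> x \in S.1 /\ y \in S.1).

Definition subdigraph (G : digraph) (S : {set G} * {set G * G}) : digraph :=
  @Digraph {x : G | x \in S.1} [set p | (val p.1, val p.2) \in S.2].

Definition copies (H G : digraph) : {set {set G} * {set G * G}} :=
  [set S | `[< is_subdigraph S /\ digraph_iso (subdigraph S) H >]].

(* Main.v *)
(** Write x_B for the number of common in-neighbours of a t-set B of vertices.
Counting stars in two ways, the sum of the x_B is the sum over the vertices v
of 'C(d(v), t), where d is the out-degree. As t! 'C(d, t) >= (d - t + 1)^t,
the tangent line of x^t at b = e s^(1/t) n^(1 - 1/t) bounds t! times this sum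
from below by e^t s n^t - O(n b^(t-1)). Since 'C(x, s) >= x - (s - 1), the
number of copies times t! is at least (e^t s - (s - 1) - o(1)) n^t, hence at
least (e^t - o(1)) n^t. The o(1) vanishes for t = 1, and is absorbed by the
strict inequality t! < t^t for t >= 2. *)

Require Import Defs.
From mathcomp Require Import all_boot all_order all_algebra.
From mathcomp Require Import reals sequences exp.
From mathcomp Require Import boolp zify ring lra.

Set Implicit Arguments.
Unset Strict Implicit.
Unset Printing Implicit Defensive.
Import Order.TTheory GRing.Theory Num.Theory.
Local Open Scope ring_scope.

Lemma leq_bin_add (x k : nat) : (x <= 'C(x, k.+1) + k)%N.
Proof.
elim: x => [//|x IH]; rewrite binS.
have [lekx|ltxk] := leqP k x; last by lia.
have : (0 < 'C(x, k))%N by rewrite bin_gt0.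
by lia.
Qed.

Lemma leq_exp_ffact (d t : nat) : ((d.+1 - t) ^ t <= d ^_ t)%N.
Proof.
rewrite ffact_prod -[X in (_ ^ X)%N]card_ord -prod_nat_const.
by apply: leq_prod => i _; have := ltn_ord i; lia.
Qed.

Lemma ffact_leq_exp (d t : nat) : (d ^_ t <= d ^ t)%N.
Proof.
rewrite ffact_prod -[X in (_ <= _ ^ X)%N]card_ord -prod_nat_const.
by apply: leq_prod => i _; rewrite leq_subr.
Qed.

Lemma fact_lt_exp (t : nat) : (1 < t)%N -> (t`! < t ^ t)%N.
Proof.
case: t => [|[|t]] // _; elim: t => [//|t IH].
rewrite factS expnS ltn_pmul2l //; apply: (leq_trans IH).
by rewrite leq_exp2r.
Qed.

(** Convexity by induction: the gap at exponent [k.+2] is [x] times the gap at [k.+1], plus the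
    nonnegative term [k.+1%:R * b ^+ k * (x - b) ^+ 2]. *)
Lemma exprS_tangent (R : realDomainType) (x b : R) (k : nat) :
  0 <= x -> 0 <= b -> b ^+ k.+1 + k.+1%:R * b ^+ k * (x - b) <= x ^+ k.+1.
Proof.
move=> x0 b0; elim: k => [|k IH].
  by rewrite !expr1 expr0 mulr1 mul1r addrC subrK.
rewrite -subr_ge0.
have -> : x ^+ k.+2 - (b ^+ k.+2 + k.+2%:R * b ^+ k.+1 * (x - b)) =
  x * (x ^+ k.+1 - (b ^+ k.+1 + k.+1%:R * b ^+ k * (x - b))) +
  k.+1%:R * b ^+ k * (x - b) ^+ 2.
  by rewrite -(natr1 k.+1) !exprS; ring.
by rewrite addr_ge0 // mulr_ge0 ?subr_ge0 ?sqr_ge0 // mulr_ge0 ?exprn_ge0.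
Qed.

Section CompletePairs.
Variable G : digraph.

Definition outN (x : G) : {set G} := [set y | (x, y) \in arcs G].

Definition commonInN (B : {set G}) : {set G} := [set x | B \subset outN x].

Lemma sum_outdegree : (\sum_(x : G) #|outN x| = #|arcs G|)%N.
Proof.
rewrite -sum1_card (eq_bigr (fun x => \sum_(y | (x, y) \in arcs G) 1)%N).
  by rewrite pair_big_dep /=; apply: eq_bigl => -[].
by move=> x _; rewrite -sum1_card; apply: eq_bigl => y; rewrite inE.
Qed.

Lemma sum_commonInN (t : nat) :
  (\sum_(B : {set G} | #|B| == t) #|commonInN B| =
   \sum_(x : G) 'C(#|outN x|, t))%N.
Proof.
transitivity (\sum_(B : {set G} | #|B| == t) \sum_(x in commonInN B) 1)%N.
  by apply: eq_bigr => B _; rewrite sum1_card.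
rewrite (exchange_big_dep predT) //=; apply: eq_bigr => x _.
rewrite -cards_draws -sum1_card; apply: eq_bigl => B.
by rewrite !inE andbC.
Qed.

Definition complete_pairs (s t : nat) : {set {set G} * {set G}} :=
  [set p : {set G} * {set G} |
    [&& #|p.2| == t, p.1 \subset commonInN p.2 & #|p.1| == s]].

Lemma card_complete_pairs (s t : nat) :
  #|complete_pairs s t| =
  (\sum_(B : {set G} | #|B| == t) 'C(#|commonInN B|, s))%N.
Proof.
under eq_bigr do rewrite -cards_draws -sum1_card.
rewrite pair_big_dep /= -sum1_card.
rewrite (reindex_inj (h := fun p => (p.2, p.1))) /=.
  2: by move=> [? ?] [? ?] [-> ->].
by apply: eq_bigl => -[A B]; rewrite !inE.
Qed.

Lemma complete_arcs (A B : {set G}) :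
  A \subset commonInN B -> setX A B \subset arcs G.
Proof.
move=> /subsetP sAB; apply/subsetP => -[x y]; rewrite in_setX => /andP[xA yB].
by move: (sAB x xA); rewrite inE => /subsetP /(_ y yB); rewrite inE.
Qed.

(** Ensures that distinct complete pairs give distinct copies: fixing one vertex on one side, the
    arcs at it reveal the other side. *)
Lemma setX_inj_nonempty (A B A' B' : {set G}) :
  (0 < #|A|)%N -> (0 < #|B|)%N -> setX A B = setX A' B' -> A = A' /\ B = B'.
Proof.
move=> /card_gt0P[a aA] /card_gt0P[b bB] /setP e.
have [aA' bB'] : a \in A' /\ b \in B'.
  by apply/andP; rewrite -in_setX -e in_setX aA.
split; apply/setP => z.
  by have := e (z, b); rewrite !in_setX bB bB' !andbT.
by have := e (a, z); rewrite !in_setX aA aA'.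
Qed.

Lemma complete_pair_iso (A B : {set G}) :
  [disjoint A & B] -> (0 < #|A|)%N -> (0 < #|B|)%N ->
  digraph_iso (subdigraph (A :|: B, setX A B)) (antidirected_Kst #|A| #|B|).
Proof.
move=> dAB /card_gt0P[a aA] /card_gt0P[b bB].
pose f (x : {x : G | x \in A :|: B}) : 'I_#|A| + 'I_#|B| :=
  if val x \in A then inl (enum_rank_in aA (val x))
  else inr (enum_rank_in bB (val x)).
have inB (x : {x : G | x \in A :|: B}) : val x \in A = false -> val x \in B.
  by move=> xA; have := valP x; rewrite inE xA.
exists f; split.
  (* Injectivity suffices: since [A] and [B] are disjoint, both vertex sets have [#|A| + #|B|]
     elements. *)
  apply: inj_card_bij.
    move=> x y; rewrite /f.
    case xA: (val x \in A); case yA: (val y \in A) => // -[] /enum_rank_in_inj e.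
      by apply: val_inj; apply: e.
    by apply: val_inj; apply: e; apply: inB.
  rewrite card_sum !card_ord card_sig.
  apply: (@leq_trans #|A :|: B|); last by apply/eq_leq/eq_card.
  rewrite cardsU.
  by rewrite (eqP (_ : A :&: B == set0)) ?setI_eq0 // cards0 subn0.
move=> x y; rewrite /antidirected_Kst /subdigraph !inE /= /f.
case xA: (val x \in A); case yA: (val y \in A) => /=.
- by rewrite (disjointFr dAB yA); apply/negbTE/imset2P => -[i j _ _ []].
- rewrite (inB y yA); apply/imset2P.
  by exists (enum_rank_in aA (val x)) (enum_rank_in bB (val y)).
- by apply/negbTE/imset2P => -[i j _ _ []].
- by apply/negbTE/imset2P => -[i j _ _ []].
Qed.

Lemma leq_complete_pairs_copies (s t : nat) :
  (forall x : G, (x, x) \notin arcs G) -> (0 < s)%N -> (0 < t)%N ->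
  (#|complete_pairs s t| <= #|copies (antidirected_Kst s t) G|)%N.
Proof.
move=> irr s0 t0.
pose h (p : {set G} * {set G}) := (p.1 :|: p.2, setX p.1 p.2).
have /card_in_imset <- : {in complete_pairs s t &, injective h}.
  move=> [A B] [A' B']; rewrite !inE /=.
  move=> /and3P[/eqP tB _ /eqP sA] _ [_ /setX_inj_nonempty].
  by rewrite sA tB => /(_ s0 t0) [-> ->].
apply/subset_leq_card/subsetP => _ /imsetP[[A B] + ->]; rewrite !inE /=.
move=> /and3P[/eqP tB /complete_arcs sAB /eqP sA]; apply/asboolP; split.
  split=> //= x y; rewrite in_setX => /andP[xA yB].
  by rewrite !inE xA yB orbT.
rewrite -sA -tB; apply: complete_pair_iso; rewrite ?sA ?tB //.
(* A vertex on both sides would carry a loop. *)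
rewrite -setI_eq0; apply/eqP/setP => x; rewrite !inE.
apply/negbTE/negP => /andP[xA xB].
by have := irr x; rewrite (subsetP sAB) // in_setX xA.
Qed.

(* Linearizing the binomial coefficient by x <= 'C(x, s + 1) + s loses nothing
   here: the average common in-degree of a t-set is at least about e ^ t * s,
   and e ^ t * s - (s - 1) >= e ^ t. *)
Lemma sum_ffact_outdegree_leq (s t : nat) :
  (forall x : G, (x, x) \notin arcs G) -> (0 < t)%N ->
  (\sum_(x : G) #|outN x| ^_ t <=
   t`! * #|copies (antidirected_Kst s.+1 t) G| + s * #|G| ^ t)%N.
Proof.
move=> irr t0.
under eq_bigr do rewrite -bin_ffact.
rewrite -big_distrl /= -sum_commonInN mulnC.
have le1 : (\sum_(B : {set G} | #|B| == t) #|commonInN B| <=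
    #|copies (antidirected_Kst s.+1 t) G| + s * 'C(#|G|, t))%N.
  apply: (@leq_trans (\sum_(B : {set G} | #|B| == t)
    ('C(#|commonInN B|, s.+1) + s))).
    by apply: leq_sum => B _; exact: leq_bin_add.
  rewrite big_split /= -card_complete_pairs.
  apply: leq_add; first exact: leq_complete_pairs_copies.
  by rewrite sum_nat_const mulnC -cardsE card_draws.
apply: (leq_trans (leq_mul (leqnn t`!) le1)).
rewrite mulnDr leq_add2l mulnCA leq_mul2l mulnC bin_ffact ffact_leq_exp.
by rewrite orbT.
Qed.

Lemma tangent_leq_sum_ffact (R : realDomainType) (t : nat) (b : R) :
  0 <= b ->
  #|G|%:R * b ^+ t.+1 + t.+1%:R * b ^+ t * (#|arcs G|%:R - #|G|%:R * (t%:R + b))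
  <= (\sum_(x : G) #|outN x| ^_ t.+1)%N%:R.
Proof.
move=> b0; rewrite natr_sum.
apply: (@le_trans _ _ (\sum_(x : G)
  (b ^+ t.+1 + t.+1%:R * b ^+ t * (#|outN x|%:R - (t%:R + b))))).
  rewrite big_split /= -mulr_sumr sumrB -natr_sum sum_outdegree !sumr_const.
  by rewrite -(mulr_natl (b ^+ t.+1)) -(mulr_natl (t%:R + b)).
apply: ler_sum => x _.
apply: (@le_trans _ _ (((#|outN x|.+1 - t.+1) ^ t.+1)%N%:R)); last first.
  by rewrite ler_nat leq_exp_ffact.
rewrite natrX; apply: le_trans (exprS_tangent _ (ler0n _ _) b0).
(* The slope is nonnegative and truncated subtraction is at least the real difference, so
   out-degrees below [t] cause no trouble. *)
rewrite lerD2l ler_wpM2l ?mulr_ge0 ?exprn_ge0 // opprD addrA lerD2r.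
by rewrite subSS lerBlDr -natrD ler_nat; lia.
Qed.

End CompletePairs.

Theorem theorem1p11 (R : realType) (s t : nat) (hs : (1 <= s)%N)
    (ht : (1 <= t)%N) :
  exists n0 : nat, forall n : nat, (n0 <= n)%N ->
  forall G : digraph, oriented G -> #|G| = n ->
    expR 1 * (s%:R `^ (1 / t%:R)) * (n%:R `^ (2 - 1 / t%:R))
      <= #|arcs G|%:R :> R ->
    (expR 1 / t%:R) ^+ t * n%:R ^+ t
      <= #|copies (antidirected_Kst s t) G|%:R :> R.
Proof.
(* From here on the sides have sizes [s.+1] and [t.+1], written [S] and [T] in [R]. *)
case: s hs => // s _; case: t ht => // t _.
(* K <= b makes the first-order error of the tangent bound at most the gap
   between t`! / t ^ t and 1. *)
pose K := (t.+1 * t * s.+1 * t.+1 ^ t.+1)%N.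
exists (K ^ t.+1).+1 => n hn G [irr _] cG hm.
set c : R := #|copies _ _|%:R.
set E : R := expR 1.
have E1 : 1 <= E by rewrite -expR0 ler_expR.
set N : R := n%:R.
have N0 : 0 < N by rewrite ltr0n; lia.
have N1 : 1 <= N by rewrite ler1n; lia.
pose T : R := t.+1%:R; pose S : R := s.+1%:R.
have T0 : 0 < T by rewrite ltr0n.
have T0' : T != 0 by rewrite gt_eqF.
pose b : R := E * (S `^ (1 / T)) * (N `^ (1 - 1 / T)).
have S0 : 0 < S by rewrite ltr0n.
have E0 : 0 < E by rewrite expR_gt0.
have b0 : 0 < b by rewrite /b !mulr_gt0 ?powR_gt0.
have rootX (x : R) (y : R) : (x `^ y) ^+ t.+1 = x `^ (y * T).
  by rewrite powRrM powR_mulrn ?powR_ge0.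
have bX : b ^+ t.+1 = E ^+ t.+1 * S * N ^+ t.
  rewrite /b !exprMn !rootX mulfVK // powRr1 ?(ltW S0) //; congr (_ * _).
  by rewrite mulrBl mulfVK // mul1r /T -natr1 addrK powR_mulrn // ltW.
have Nb : N * b <= #|arcs G|%:R.
  suff -> : N * b = E * S `^ (1 / T) * N `^ (2 - 1 / T) by [].
  rewrite (_ : 2 - 1 / T = 1 + (1 - 1 / T)); last by ring.
  rewrite powRD; last by rewrite (gt_eqF N0) implybT.
  by rewrite powRr1 ?(ltW N0) // /b mulrCA.
have EX1 : 1 <= E ^+ t.+1 by apply: exprn_ege1.
have S1 : 1 <= S by rewrite ler1n.
have NX0 : 0 <= N ^+ t.+1 by rewrite exprn_ge0 // ltW.
have lower := tangent_leq_sum_ffact G t (ltW b0).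
have upper : (\sum_(x : G) #|outN x| ^_ t.+1)%N%:R <=
    t.+1`!%:R * c + s%:R * N ^+ t.+1 :> R.
  by rewrite -natrX -!natrM -natrD ler_nat -cG sum_ffact_outdegree_leq.
rewrite expr_div_n mulrAC ler_pdivrMr ?exprn_gt0 //.
(* As [b] is at most the average out-degree, the linear term of the tangent bound loses only the
   shift by [t] at each vertex. *)
have {lower upper} main : E ^+ t.+1 * S * N ^+ t.+1 - T * t%:R * (N * b ^+ t)
    <= t.+1`!%:R * c + s%:R * N ^+ t.+1.
  apply: le_trans upper; apply: le_trans lower; rewrite cG -/N -/T bX.
  have : 0 <= T * b ^+ t * (#|arcs G|%:R - N * b).
    by rewrite !mulr_ge0 ?subr_ge0 ?exprn_ge0 // ltW.
  by rewrite (exprS N); lra.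
(* Since [S] is [s%:R + 1], this uses [E ^+ t.+1 * S - s%:R >= E ^+ t.+1]. *)
have {}main : E ^+ t.+1 * N ^+ t.+1 - T * t%:R * (N * b ^+ t) <= t.+1`!%:R * c.
  have : 0 <= s%:R * (E ^+ t.+1 - 1) * N ^+ t.+1.
    by rewrite !mulr_ge0 // subr_ge0.
  by move: main; rewrite /S -natr1; lra.
(* When the sink side is a single vertex, the error term has the factor [t%:R = 0]. *)
have [t0|tgt0] := posnP t.
  by move: main; rewrite t0 mulr0 mul0r subr0 expr1 mul1r mulr1.
have bK : K%:R <= b.
  rewrite -(@ler_pXn2r _ t.+1) ?nnegrE ?ler0n ?(ltW b0) // bX -natrX.
  apply: (@le_trans _ _ N); first by rewrite ler_nat ltnW.
  rewrite (le_trans (ler_eXnr tgt0 N1)) // ler_peMl ?exprn_ge0 ?(ltW N0) //.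
  by rewrite mulr_ege1.
(* Multiplying by [b] turns [b ^+ t] into the power computed in [bX]; the constants then collect
   into [K], and [bK] concludes. *)
have error : T ^+ t.+1 * (T * t%:R * (N * b ^+ t)) <= E ^+ t.+1 * N ^+ t.+1.
  rewrite -(ler_pM2r b0).
  have -> : T ^+ t.+1 * (T * t%:R * (N * b ^+ t)) * b =
      K%:R * (E ^+ t.+1 * N ^+ t.+1).
    rewrite (_ : _ * b = T ^+ t.+1 * T * t%:R * N * b ^+ t.+1); last first.
      by rewrite (exprS b); ring.
    by rewrite bX /K !natrM natrX -/T -/S (exprS N); ring.
  by rewrite mulrC ler_wpM2l // mulr_ge0 // exprn_ge0 // expR_ge0.
have factT : t.+1`!%:R + 1 <= T ^+ t.+1 :> R.
  by rewrite natr1 -natrX ler_nat fact_lt_exp.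
rewrite -(ler_pM2l (_ : 0 < t.+1`!%:R :> R)) ?ltr0n ?fact_gt0 //.
have P0 : 0 <= E ^+ t.+1 * N ^+ t.+1 by rewrite mulr_ge0 // exprn_ge0 // expR_ge0.
have step1 : 0 <= T ^+ t.+1 *
    (t.+1`!%:R * c - (E ^+ t.+1 * N ^+ t.+1 - T * t%:R * (N * b ^+ t))).
  by rewrite mulr_ge0 ?exprn_ge0 ?subr_ge0 // ltW.
have step2 : 0 <= (T ^+ t.+1 - (t.+1`!%:R + 1)) * (E ^+ t.+1 * N ^+ t.+1).
  by rewrite mulr_ge0 // subr_ge0.
by lra.
Qed.
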